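(* Let $n\in\mathbb{N}$ and let $P=\mathbb{N}_0^n$ with the componentwise partial order. Let $U\subset P$ be an upset such that $\partial\mathrm{oc}(U)\neq\emptyset$. Then there is a unique representation of $U$ in the form $U=V\cap W$, where $V,W$ are upsets of $P$, $V$ is cofinite, $\partial\mathrm{oc}(W)=\emptyset$, and $\partial\mathrm{oc}(U)=\partial\mathrm{oc}(V)$.
   Context: $\mathbb{N}_0$ is the set of non-negative integers. A subset $U\subseteq P$ is an upset if $x\geq y\in U$ implies $x\in U$ (so $P$ itself is an upset); it is cofinite if $P\setminus U$ is finite. For an upset $U$, $\partial\mathrm{oc}(U):=\max(P\setminus U)$ is the set of maximal elements of $P\setminus U$. *)

(* Defs.v *)
From mathcomp Require Import all_boot all_order.
From mathcomp Require Import boolp classical_sets functions cardinality.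

Set Implicit Arguments.
Unset Strict Implicit.
Unset Printing Implicit Defensive.

Import Order.TTheory.
Local Open Scope classical_set_scope.

(* [n.-tupleprod nat] is the type of n-tuples of natural numbers carrying the
   componentwise (as opposed to lexicographic) order. *)
Notation natvec n := (n.-tupleprod nat).

Section Upsets.
Context {d : Order.disp_t} {P : porderType d}.
Implicit Types A U : set P.

Definition upset U : Prop := forall x y : P, (y <= x)%O -> U y -> U x.

Definition cofinite U : Prop := finite_set (~` U).

Definition maximals A : set P :=
  [set m | A m /\ forall x : P, A x -> (m <= x)%O -> x = m].

Definition boundary_oc U : set P := maximals (~` U).

End Upsets.

(* Main.v *)
(* Writing [M] for the boundary of [U], both factors are forced. Every element of
   a finite downset lies below a maximal one, so [~` V] must be the downset
   generated by [M]; it is finite because antichains of [nat^n] are finite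
   (Dickson) and so are principal downsets. Next, a downset without maximal
   elements that contains [a] has infinitely many elements above [a], hence one
   outside [~` V]; so [~` W] must be the downset generated by [~` U `&` V]. A
   maximal element of that downset would be maximal in [~` U], hence in [M], which
   is disjoint from [V]. *)
Require Import Defs.
From mathcomp Require Import all_boot all_order.
From mathcomp Require Import boolp classical_sets functions cardinality.

Set Implicit Arguments.
Unset Strict Implicit.
Unset Printing Implicit Defensive.

Import Order.TTheory.
Local Open Scope classical_set_scope.

Section Downclosure.
Context {d : Order.disp_t} {P : porderType d}.
Implicit Types A U : set P.

Definition down A : set P := [set x | exists2 a, A a & (x <= a)%O].

Lemma subset_down A : A `<=` down A.
Proof. by move=> x Ax; exists x. Qed.

Lemma upset_downC A : upset (~` down A).
Proof.
by move=> x y yx nAy [a Aa xa]; apply: nAy; exists a => //; exact: le_trans xa.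
Qed.

Lemma upsetC_down U : upset U -> down (~` U) `<=` ~` U.
Proof. by move=> hU x [y nUy xy] Ux; apply: nUy; exact: hU xy Ux. Qed.

Lemma maximals_down A : maximals (down A) `<=` A.
Proof.
by move=> m [[a Aa ma] mmax]; rewrite -(mmax a) //; exact: subset_down.
Qed.

(** Maximal elements form an antichain, so passing to the generated downset puts nothing new above
    them. *)
Lemma down_maximalsK A : maximals (down (maximals A)) = maximals A.
Proof.
apply/seteqP; split; first exact: maximals_down.
move=> m Mm; split; first exact: subset_down.
move=> x [y [Ay _] xy] mx; apply/le_anti; rewrite mx andbT.
by case: Mm => _ /(_ _ Ay (le_trans mx xy)) <-.
Qed.

Lemma finite_subset_down_maximals A : finite_set A -> A `<=` down (maximals A).
Proof.
(* Induction on a bound [k] for the size: if [a] is not maximal, recurse into the elements strictly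
   above [a]. A maximal one among these is maximal in all of [s]. *)
move=> /finite_seqP[s ->]; move: {2}(size s) (leqnn (size s)) => k.
elim: k s => [|k IH] s sk a /= a_s.
  by move: sk a_s; rewrite leqn0 => /nilP ->.
have [[b [b_s ab]]|amax] := pselect (exists b, b \in s /\ (a < b)%O); last first.
  exists a => //; split => // x /= x_s ax; apply/eqP/negP => xa; apply: amax.
  by exists x; split=> //; rewrite lt_def ax andbT; exact/negP.
pose t := [seq x <- s | (a < x)%O].
have tk : size t <= k.
  (* The filter drops at least [a] itself, so [t] is strictly shorter than [s]. *)
  rewrite -ltnS (leq_trans _ sk) // size_filter -(count_predC (fun x => a < x)%O).
  rewrite -[ltnLHS]addn0 ltn_add2l -has_count.
  by apply/hasP; exists a => //=; rewrite ltxx.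
have b_t : b \in t by rewrite mem_filter ab.
have [m [/= m_t mmax] bm] := IH t tk b b_t.
move: m_t; rewrite mem_filter => /andP[am m_s].
exists m; last exact: ltW.
split=> // x /= x_s mx; apply: mmax => //=.
by rewrite mem_filter x_s (lt_le_trans am mx).
Qed.

(** An element of [A] above a point outside [down (maximals A)] is outside it too. Hence a maximal
    element of the new downset would already be maximal in [A], a contradiction. *)
Lemma maximals_down_setD A : maximals (down (A `\` down (maximals A))) = set0.
Proof.
apply/seteqP; split=> // a aM.
have [Aa nMa] := maximals_down aM; apply: (nMa); apply: subset_down.
split=> // x Ax ax; case: aM => _; apply=> //; apply: subset_down.
by split=> // -[m Mm xm]; apply: nMa; exists m => //; exact: le_trans xm.
Qed.

(** If all elements of [A] above [a] were in [F], they would form a finite set containing [a]. A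
    maximal element of this set would be maximal in [A]. *)
Lemma no_maximals_setD A F : maximals A = set0 -> finite_set F ->
  A `<=` down (A `\` F).
Proof.
move=> A0 finF a Aa; apply: contrapT => nAFa.
have AF : [set x | A x /\ (a <= x)%O] `<=` F.
  by move=> x [Ax ax]; apply: contrapT => nFx; apply: nAFa; exists x.
have := @finite_subset_down_maximals _ (sub_finite_set AF finF) a.
case=> [//|m [[Am am] mmax] _].
rewrite -[False]/(set0 m) -A0; split=> // x Ax mx.
by apply: mmax => //; split=> //; exact: le_trans mx.
Qed.

End Downclosure.

(** By well-ordering, [f] attains its minimum over each tail [m <= j], at an index [h m]. Jumping
    repeatedly to the minimum of the tail past the current index gives [g]. *)
Lemma nat_nondecreasing_subseq (f : nat -> nat) : exists2 g : nat -> nat,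
  {homo g : i j / i < j} & {homo f \o g : i j / i <= j}.
Proof.
have /choice[h hP] (m : nat) : exists i, m <= i /\ forall j, m <= j -> f i <= f j.
  have ex : exists v, `[< exists2 i, m <= i & f i = v >].
    by exists (f m); apply/asboolP; exists m.
  case: (ex_minnP ex) => v /asboolP[i mi <-] vmin; exists i; split=> // j mj.
  by apply: vmin; apply/asboolP; exists j.
pose g k := iter k (fun i => h i.+1) (h 0).
have g_incr : {homo g : i j / i < j}.
  by apply: homo_ltn => [|i]; [exact: ltn_trans|case: (hP (g i).+1)].
exists g => //; apply: homo_leq => [//||[|i]]; first exact: leq_trans.
  by case: (hP 0) => _; apply.
case: (hP (g i).+1) => _; apply.
by apply: (ltn_trans (n := g i.+1)); exact: g_incr.
Qed.

Section NatVec.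
Variable n : nat.
Implicit Types A : set (natvec n).

(** Dickson's lemma for sequences: subsequences are extracted one coordinate at a time, and each
    refinement keeps the coordinates already treated nondecreasing. *)
Lemma natvec_nondecreasing_subseq (u : nat -> natvec n) :
  exists2 g : nat -> nat,
    {homo g : i j / i < j} & forall i j, i <= j -> (u (g i) <= u (g j))%O.
Proof.
suff [g g_incr g_mono] : exists2 g : nat -> nat, {homo g : i j / i < j} &
    forall c, c \in enum 'I_n ->
      {homo (fun k => tnth (u (g k)) c) : i j / i <= j}.
  exists g => // i j ij; rewrite leEtprod; apply/forallP => c.
  by rewrite leEnat g_mono ?mem_enum.
elim: (enum 'I_n) => [|c s [g g_incr g_mono]]; first by exists id.
have [h h_incr h_mono] := nat_nondecreasing_subseq (fun k => tnth (u (g k)) c).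
exists (g \o h) => [i j ij|c']; first exact/g_incr/h_incr.
rewrite inE => /predU1P[-> //|c's] i j ij /=.
by apply: g_mono => //; exact: (ltnW_homo h_incr).
Qed.

Lemma finite_natvec_antichain A :
  (forall x y, A x -> A y -> (x <= y)%O -> x = y) -> finite_set A.
Proof.
move=> antiA; apply: contrapT => /infiniteP/pcard_leP/injfunPex[u uA u_inj].
have [g g_incr g_mono] := natvec_nondecreasing_subseq u.
have /u_inj : u (g 0) = u (g 1) by apply: antiA; [exact: uA..|exact: g_mono].
by rewrite !inE => /(_ I I) g01; have := g_incr 0 1 isT; rewrite g01 ltnn.
Qed.

Lemma finite_natvec_le (m : natvec n) : finite_set [set x : natvec n | (x <= m)%O].
Proof.
pose k := \max_(i < n) tnth m i.
(* Every vector below [m] has entries at most [k], so it is in the image of this finite type. *)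
pose f (t : n.-tuple 'I_k.+1) : natvec n := map_tuple val t.
apply: (@sub_finite_set _ _ (f @` setT)); last exact: finite_image.
move=> x /=; rewrite leEtprod => /forallP xm.
exists [tuple inord (tnth x i) | i < n] => //.
apply: eq_from_tnth => i; rewrite tnth_map tnth_mktuple /= inordK // ltnS.
by apply: leq_trans (xm i) _; exact: (leq_bigmax (F := fun i => tnth m i)).
Qed.

Lemma finite_natvec_down_maximals A : finite_set (down (maximals A)).
Proof.
have -> : down (maximals A) = \bigcup_(m in maximals A) [set x | (x <= m)%O].
  by apply/seteqP; split=> x [m Mm xm]; exists m.
apply: bigcup_finite => [|m _]; last exact: finite_natvec_le.
apply: finite_natvec_antichain => x y [_ xmax] [Ay _] xy.
by rewrite (xmax y).
Qed.

End NatVec.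

Theorem corollary5p11 (n : nat) (hn : (0 < n)%N) (U : set (natvec n))
    (hU : upset U) (hmax : boundary_oc U <> set0) :
  exists! VW : set (natvec n) * set (natvec n),
    U = VW.1 `&` VW.2 /\ upset VW.1 /\ upset VW.2 /\ cofinite VW.1 /\
    boundary_oc VW.2 = set0 /\ boundary_oc U = boundary_oc VW.1.
Proof.
pose E := ~` U; pose F := down (maximals E).
have FE : F `<=` E.
  by move=> x [m [Em _] xm]; apply: (upsetC_down hU); exists m.
have finF : finite_set F by exact: finite_natvec_down_maximals.
exists (~` F, ~` down (E `\` F)); split=> /=.
  split.
    rewrite -setCU -[LHS]setCK -/E; congr (~` _).
    apply/seteqP; split=> x.
      by move=> Ex; have [Fx|nFx] := pselect (F x); [left|right; exists x].
    by move=> [/FE//|[y [Ey _] xy]]; apply: (upsetC_down hU); exists y.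
  do 2![split; first exact: upset_downC].
  rewrite /cofinite /boundary_oc !setCK -/E.
  by split; [|split; [exact: maximals_down_setD|rewrite down_maximalsK]].
move=> [V W] /= [UVW [hV [hW [finV [W0 UV]]]]].
have VF : ~` V = F.
  rewrite /F -[maximals E]/(boundary_oc U) UV; apply/seteqP; split.
    exact: finite_subset_down_maximals.
  by move=> x [m [nVm _] xm]; apply: (upsetC_down hV); exists m.
have EVW : E = F `|` ~` W by rewrite /E UVW setCI VF.
have EWF : E `\` F = ~` W `\` F by rewrite EVW setDUl setDv set0U.
congr pair; first by rewrite -VF setCK.
rewrite -[RHS]setCK EWF; congr (~` _); apply/seteqP; split.
  by move=> x [y [nWy _] xy]; apply: (upsetC_down hW); exists y.
exact: no_maximals_setD.
Qed.
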